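(* Let $\mathbb{X}$ and $\mathbb{Y}$ be Hausdorff topological spaces, let $\Phi:\mathbb{X}\to 2^{\mathbb{Y}}\setminus\{\emptyset\}$ be a set-valued mapping, let $u:\mathrm{Gr}_{\mathbb{X}}(\Phi)\subseteq\mathbb{X}\times\mathbb{Y}\to\overline{\mathbb{R}}$, and let $x\in\mathbb{X}$. Each of the following two assumptions (separately): (i) the function $u:\mathrm{Gr}_{\mathbb{X}}(\Phi)\subseteq\mathbb{X}\times\mathbb{Y}\to\overline{\mathbb{R}}$ is upper semi-continuous at all $(x,y)\in\mathrm{Gr}_{\{x\}}(\Phi)$ and the set-valued mapping $\Phi$ is lower semi-continuous at $x$; (ii) $\Phi^*(x)$ is a nonempty compact subset of $\mathbb{Y}$, the function $u:\mathrm{Gr}_{\mathbb{X}}(\Phi)\subseteq\mathbb{X}\times\mathbb{Y}\to\overline{\mathbb{R}}$ is upper semi-continuous at all $(x,y)\in\mathrm{Gr}_{\{x\}}(\Phi^* )$, and for each neighborhood $\mathcal{O}(\Phi^*(x))$ of the set $\Phi^*(x)$ there exists a neighborhood $\mathcal{O}(x)$ of $x$ such that $\mathcal{O}(\Phi^*(x))\cap\Phi(x^* )\ne\emptyset$ for all $x^*\in\mathcal{O}(x)$; implies that the value function $v:\mathbb{X}\to\overline{\mathbb{R}}$ is upper semi-continuous at $x$.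
   Context: $\overline{\mathbb{R}}=\mathbb{R}\cup\{\pm\infty\}$. For $Z\subseteq\mathbb{X}$ and a set-valued mapping $F:\mathbb{X}\to 2^{\mathbb{Y}}$, $\mathrm{Gr}_Z(F)=\{(x,y)\in Z\times\mathbb{Y}: y\in F(x)\}$. The value function is $v(z):=\inf_{y\in\Phi(z)}u(z,y)$, $z\in\mathbb{X}$, and the solution multifunction is $\Phi^*(z):=\{y\in\Phi(z): v(z)=u(z,y)\}$, $z\in\mathbb{X}$. For a nonempty subset $A$ of a Hausdorff topological space $\mathbb{A}$, a function $f:A\subseteq\mathbb{A}\to\overline{\mathbb{R}}$ is lower semi-continuous at $a\in A$ if $\liminf_i f(a_i)\ge f(a)$ for each net $\{a_i\}_{i\in I}\subset A$ converging to $a$ in $\mathbb{A}$; it is upper semi-continuous at $a$ if $-f$ is lower semi-continuous at $a$. The set-valued mapping $\Phi:\mathbb{X}\to 2^{\mathbb{Y}}\setminus\{\emptyset\}$ is lower semi-continuous at $x$ if for each open set $\mathcal{G}\subseteq\mathbb{Y}$ with $\Phi(x)\cap\mathcal{G}\ne\emptyset$ there is a neighborhood $\mathcal{O}(x)$ of $x$ such that $\Phi(x^* )\cap\mathcal{G}\ne\emptyset$ for all $x^*\in\mathcal{O}(x)$. *)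

(* Defs.v *)
From mathcomp Require Import all_boot all_order all_algebra.
From mathcomp Require Import all_classical all_reals all_analysis.

Set Implicit Arguments.
Unset Strict Implicit.
Unset Printing Implicit Defensive.

Import Order.TTheory GRing.Theory Num.Theory.

Local Open Scope classical_set_scope.
Local Open Scope ereal_scope.

(* The index set of a net: a nonempty preordered set in which any two elements
   have a common upper bound; antisymmetry is not assumed. *)
Record directed (I : Type) (le : I -> I -> Prop) : Prop := Directed {
  directed_inhabited : inhabited I ;
  directed_refl : forall i, le i i ;
  directed_trans : forall i j k, le i j -> le j k -> le i k ;
  directed_ub : forall i j, exists k, le i k /\ le j k }.

Definition net_cvg (T : topologicalType) (I : Type) (le : I -> I -> Prop)
    (s : I -> T) (a : T) : Prop :=
  forall V, nbhs a V -> exists i, forall j, le i j -> V (s j).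

Definition net_liminf (R : realType) (I : Type) (le : I -> I -> Prop)
    (r : I -> \bar R) : \bar R :=
  ereal_sup [set ereal_inf [set r j | j in [set j | le i j]] | i in [set: I]].

(* A function defined on A `<=` T is represented by a total function f on T,
   of which only the values on A matter: the nets range over A. *)
Definition lower_semicontinuous_at (R : realType) (T : topologicalType)
    (A : set T) (f : T -> \bar R) (a : T) : Prop :=
  forall (I : Type) (le : I -> I -> Prop) (s : I -> T),
    directed le -> (forall i, A (s i)) -> net_cvg le s a ->
    f a <= net_liminf le (fun i => f (s i)).

Definition upper_semicontinuous_at (R : realType) (T : topologicalType)
    (A : set T) (f : T -> \bar R) (a : T) : Prop :=
  lower_semicontinuous_at A (fun t => - f t) a.

Section set_valued_mappings.
Variables (X Y : topologicalType).

Definition Gr (Z : set X) (F : X -> set Y) : set (X * Y) :=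
  [set p | Z p.1 /\ F p.1 p.2].

Definition set_valued_lsc_at (F : X -> set Y) (x : X) : Prop :=
  forall G : set Y, open G -> F x `&` G !=set0 ->
    exists2 O : set X, nbhs x O & forall z, O z -> F z `&` G !=set0.

Variables (R : realType) (u : X * Y -> \bar R) (Phi : X -> set Y).

Definition value_function (z : X) : \bar R :=
  ereal_inf [set u (z, y) | y in Phi z].

Definition solution_multifunction (z : X) : set Y :=
  [set y | Phi z y /\ value_function z = u (z, y)].

End set_valued_mappings.

(* Main.v *)
(* Upper semicontinuity at a point means that each strict upper bound of the
   value persists nearby.  If [v x < c], some [y] in [Phi x] has [u (x, y) < c],
   hence [u < c] on the part of the graph near [(x, y)].  Under (i), lower
   semicontinuity of [Phi] provides points of [Phi z] near [y] for [z] near [x];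
   under (ii), compactness of the solution set gives a tube around
   [{x} * Phi^*(x)] on which [u < c], and this tube meets [Phi z]. *)
Require Import Defs.
From mathcomp Require Import all_boot all_order all_algebra.
From mathcomp Require Import all_classical all_reals all_analysis.

Import Order.TTheory Num.Theory.

Local Open Scope classical_set_scope.

(** [contract] embeds the extended reals in [-1, 1] preserving order; the midpoint of the images is
    pulled back by [expand]. *)
Lemma ereal_between (R : realType) (a b : \bar R) :
  (a < b)%E -> exists2 c : \bar R, (a < c)%E & (c < b)%E.
Proof.
move=> ab; have mab := midf_lt (etrans (lt_contract a b) ab).
set m := (_ / 2)%R in mab.
have m1 : m \in [pred r : R | `|r| <= 1]%R.
  rewrite inE /= ler_norml; apply/andP; split.
    apply: le_trans (ltW mab.1).
    by have := contract_le1 a; rewrite ler_norml => /andP[].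
  apply: le_trans (ltW mab.2) _.
  by have := contract_le1 b; rewrite ler_norml => /andP[].
by exists (expand m); rewrite ?lt_expandRL ?lt_expandLR // mab.
Qed.

(* Necessity: otherwise, a choice of a bad point in each neighborhood of [a]
   is a net indexed by these neighborhoods, ordered by reverse inclusion. *)
Lemma upper_semicontinuous_atP (R : realType) (T : topologicalType)
    (A : set T) (f : T -> \bar R) (a : T) :
  upper_semicontinuous_at A f a <->
  forall c, (f a < c)%E -> \forall t \near a, A t -> (f t < c)%E.
Proof.
split=> [usc c fac|nearf I le s [[i0] _ _ _] sA sa].
  apply: contrapT => nfc.
  have /choice[s sP] (V : {V : set T | nbhs a V}) :
      exists t, [/\ sval V t, A t & (c <= f t)%E].
    case: V => V /= Va; apply: contrapT => nt; apply: nfc.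
    apply: filterS Va => t Vt At; rewrite ltNge.
    by apply/negP => cft; apply: nt; exists t.
  pose le (V W : {V : set T | nbhs a V}) := sval W `<=` sval V.
  have dir : directed le.
    split=> [|V|V W Z VW WZ|[V Va] [W Wa]].
    - by constructor; exists setT; exact: filterT.
    - exact: subset_refl.
    - exact: subset_trans WZ VW.
    - exists (exist _ (V `&` W) (filterI Va Wa)).
      by split=> t [].
  have sA V : A (s V) by have [] := sP V.
  have sa : net_cvg le s a.
    move=> V Va; exists (exist _ V Va) => W; apply.
    by have [] := sP W.
  have := usc _ _ _ dir sA sa; apply/negP; rewrite -ltNge.
  apply: (@le_lt_trans _ _ (- c)%E); last by rewrite lteN2.
  apply: ge_ereal_sup => _ [V _ <-].
  apply: ge_ereal_inf; exists (- f (s V))%E.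
    by exists V => //; exact: subset_refl.
  by rewrite leeN2; have [] := sP V.
(* Sufficiency: if the lower limit were below [- f a], take [c] strictly between. Then [f a < - c],
   so eventually [f (s j) < - c], and the infimum over that tail is at least [c]. *)
rewrite leNgt; apply/negP => /ereal_between[c /[swap]].
rewrite lteNr => /nearf/sa[i si]; apply/negP; rewrite -leNgt.
apply: le_ereal_sup_tmp; exists (ereal_inf [set (- f (s j))%E | j in le i]).
  by exists i.
apply: le_ereal_inf_tmp => _ [j ij <-].
by rewrite leeNr; exact/ltW/si.
Qed.

Lemma value_function_lt (X Y : topologicalType) (R : realType)
    (u : X * Y -> \bar R) (Phi : X -> set Y) (z : X) (c : \bar R) :
  (value_function u Phi z < c)%E <->
  exists2 y, Phi z y & (u (z, y) < c)%E.
Proof.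
split=> [/ereal_inf_lt[_ [y Phiy <-] uc]|[y Phiy uc]]; first by exists y.
by apply: le_lt_trans uc; apply: ereal_inf_lbound; exists y.
Qed.

(** Compactness is used as near covering, along the filter of small neighborhoods of [x]; this
    yields one [U] for all of [K]. *)
Lemma tube_nbhs (X Y : topologicalType) (x : X) (K : set Y) (P : X * Y -> Prop) :
  compact K -> (forall y, K y -> nbhs (x, y) P) ->
  exists2 U, nbhs x U & set_nbhs K [set y | forall z, U z -> P (z, y)].
Proof.
move=> /compact_near_coveringP cK KP.
have near_sub : \forall U \near powerset_filter_from (nbhs x),
    K `<=` [set y | nbhs y [set y' | forall z, U z -> P (z, y')]].
  apply: cK => y /KP [[N W] /= [Nx Wy] NWP].
  (* The interior makes [W] a neighborhood of each nearby [y'], as the covering property demands. *)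
  exists (interior W, [set U | U `<=` N]).
    by split; [exact: nbhs_interior|exact: small_set_sub].
  move=> [y' U] /= [Wy' UN].
  by apply: filterS Wy' => y'' Wy'' z /UN Nz; apply: NWP.
(* A single [U] can be extracted because the property passes to smaller sets. *)
have [U V UV VP|U Ux UP] := (near_powerset_filter_fromP _ _).1 near_sub.
  move=> y /VP; apply: filterS => y' VP' z /UV; exact: VP'.
by exists U.
Qed.

Theorem theorem4 (R : realType) (X Y : topologicalType)
    (hX : hausdorff_space X) (hY : hausdorff_space Y)
    (Phi : X -> set Y) (hPhi : forall z, Phi z !=set0)
    (u : X * Y -> \bar R) (x : X) :
  ((forall p, Gr [set x] Phi p ->
      upper_semicontinuous_at (Gr [set: X] Phi) u p) /\
   set_valued_lsc_at Phi x ->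
   upper_semicontinuous_at [set: X] (value_function u Phi) x)
  /\
  ([/\ solution_multifunction u Phi x !=set0,
       compact (solution_multifunction u Phi x),
       (forall p, Gr [set x] (solution_multifunction u Phi) p ->
          upper_semicontinuous_at (Gr [set: X] Phi) u p) &
       (forall O : set Y, set_nbhs (solution_multifunction u Phi x) O ->
          exists2 Ox : set X, nbhs x Ox &
            forall z, Ox z -> O `&` Phi z !=set0)] ->
   upper_semicontinuous_at [set: X] (value_function u Phi) x).
Proof.
(* Membership in the graph is a premise inside the set, which is thus a neighborhood in the whole
   product. *)
have good p c : upper_semicontinuous_at (Gr [set: X] Phi) u p -> (u p < c)%E ->
    nbhs p [set q | Phi q.1 q.2 -> (u q < c)%E].
  move=> /upper_semicontinuous_atP up /up; apply: filterS => q + Phiq.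
  by apply.
split=> [[usc lsc]|[_ cK usc near_Phi]]; apply/upper_semicontinuous_atP => c.
  move=> /value_function_lt[y Phiy uc].
  have [[N W] /= [Nx Wy] NWP] := good _ _ (usc (x, y) (conj erefl Phiy)) uc.
  have [|M Mx PhiW] := lsc (interior W) (@open_interior _ W).
    by exists y; split.
  near=> z => _; apply/value_function_lt.
  have [|y' [Phiy' /interior_subset Wy']] := PhiW z; first by near: z.
  by exists y' => //; apply: (NWP (z, y')) => //; split => //=; near: z.
move=> vc.
have [|U Ux /near_Phi[N Nx PhiU]] := @tube_nbhs _ _ x _
    [set q | Phi q.1 q.2 -> (u q < c)%E] cK.
  move=> y Ky; apply: good; first exact: usc.
  (* On the solution set, [u (x, y)] is the value at [x], so [vc] applies. *)
  by case: Ky => _ <-.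
near=> z => _; apply/value_function_lt.
have [|y [Uy Phiy]] := PhiU z; first by near: z.
by exists y => //; apply: Uy => //; near: z.
Unshelve. all: by end_near.
Qed.
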